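(* Let $\mathcal{D}$ be a finite discrete set, let $X\subseteq\mathcal{D}^{\mathbb{Z}}$ be a subshift, and let $\mu$ be a Borel probability measure on $X$ with respect to which the left shift $T$ is ergodic. Then the set of all $x\in X$ such that $$\frac1k\sum_{i=0}^{k-1}\alpha_{C_k(x)}\left(T^i f\right)\;\xrightarrow{k\to\infty}\;\int f\,\mathrm{d}\mu\quad\text{for all } f\in C(X)$$ is of full $\mu$-measure.
   Context: The left shift $T:\mathcal{D}^{\mathbb{Z}}\to\mathcal{D}^{\mathbb{Z}}$ is $(Tx)_n=x_{n+1}$. A subshift is a compact set $X\subseteq\mathcal{D}^{\mathbb{Z}}$ (product topology) with $TX=X$. Ergodic includes that $\mu$ is $T$-invariant. $T^i f$ denotes $f\circ T^i$; $C(X)$ is the space of complex-valued continuous functions. $C_k(x)=\{y\in X: y_j=x_j\text{ for }0\le j\le k-1\}$. For measurable $F$ with $\mu(F)>0$, $\alpha_F(f)=\frac1{\mu(F)}\int_Ff\,\mathrm{d}\mu$. For almost every $x$, $\mu(C_k(x))>0$ for all $k$, so the averages are defined for almost every $x$. *)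

(* Defs.v *)
From HB Require Import structures.
From mathcomp Require Import all_boot all_order all_algebra.
From mathcomp Require Import complex.
From mathcomp Require Import all_classical all_reals all_analysis.

Set Implicit Arguments.
Unset Strict Implicit.
Unset Printing Implicit Defensive.
Import Order.TTheory GRing.Theory Num.Theory.
Import numFieldNormedType.Exports.
Local Open Scope classical_set_scope.
Local Open Scope ring_scope.

Definition full_shift (D : finType) : Type :=
  {ptws int -> discrete_topology D}.

HB.instance Definition _ (D : finType) :=
  Topological.copy (full_shift D) {ptws int -> discrete_topology D}.

Definition shift (D : finType) (x : full_shift D) : full_shift D :=
  fun n : int => x (n + 1).

Record subshift (D : finType) := Subshift {
  subshift_set :> set (full_shift D);
  subshift_compact : compact subshift_set;
  subshift_shift : @shift D @` subshift_set = subshift_set }.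

Lemma subshift_stable (D : finType) (X : subshift D) (x : X) :
  shift (val x) \in (X : set (full_shift D)).
Proof.
apply/mem_set; rewrite -[X in X _]subshift_shift.
by exists (val x) => //; exact: set_mem (valP x).
Qed.

Definition subshift_map (D : finType) (X : subshift D) (x : X) : X :=
  exist _ (shift (val x)) (subshift_stable x).

(* In the library a measurable type has to be pointed. The nonemptiness proof
   only serves to provide this point; the topology is the subspace topology. *)
Definition pointed_subshift (D : finType) (X : subshift D)
  (X0 : (X : set (full_shift D)) !=set0) : Type := X.

Section pointed_subshift.
Variables (D : finType) (X : subshift D) (X0 : (X : set (full_shift D)) !=set0).

HB.instance Definition _ := Topological.copy (pointed_subshift X0) X.

HB.instance Definition _ := isPointed.Build (pointed_subshift X0)
  (exist _ (projT1 (cid X0)) (mem_set (projT2 (cid X0)))).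

End pointed_subshift.

Definition borel_subshift (D : finType) (X : subshift D)
  (X0 : (X : set (full_shift D)) !=set0) :=
  g_sigma_algebraType (@open (pointed_subshift X0)).

Definition invariant_measure d (Y : measurableType d) (R : realType)
    (mu : probability Y R) (T : Y -> Y) : Prop :=
  measurable_fun setT T /\
  forall A : set Y, measurable A -> mu (T @^-1` A) = mu A.

Definition ergodic d (Y : measurableType d) (R : realType)
    (mu : probability Y R) (T : Y -> Y) : Prop :=
  invariant_measure mu T /\
  forall A : set Y, measurable A -> T @^-1` A = A ->
    mu A = 0%E \/ mu A = 1%E.

(* Only meaningful when the real and imaginary parts of [f] are integrable,
   since [Rintegral] is total. *)
Definition Cintegral d (Y : measurableType d) (R : realType)
    (mu : {measure set Y -> \bar R}) (F : set Y) (f : Y -> R[i]) : R[i] :=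
  Complex (\int[mu]_(x in F) complex.Re (f x))
          (\int[mu]_(x in F) complex.Im (f x)).

(* Junk value 0 when [mu F = 0]. *)
Definition average d (Y : measurableType d) (R : realType)
    (mu : probability Y R) (F : set Y) (f : Y -> R[i]) : R[i] :=
  ((fine (mu F))%:C)%C^-1 * Cintegral mu F f.

Definition cylinder (D : finType) (X : subshift D) (k : nat) (x : X) : set X :=
  [set y : X | forall j : nat, (j < k)%N -> val y j%:Z = val x j%:Z].

(* Main.v *)
Require Import Defs.
From HB Require Import structures.
From mathcomp Require Import all_boot all_order all_algebra.
From mathcomp Require Import complex.
From mathcomp Require Import all_classical all_reals all_analysis.
From mathcomp Require Import measurable_realfun lra zify.

Set Implicit Arguments.
Unset Strict Implicit.
Unset Printing Implicit Defensive.
Import Order.TTheory GRing.Theory Num.Theory.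
Import numFieldNormedType.Exports.
Local Open Scope classical_set_scope.
Local Open Scope ring_scope.

(** For a function [u] depending only on the coordinates in [[-m, m]], the mean
of [u \o T^i] over the cylinder of length [k] of [x] is [u (T^i x)] except for
the at most [2m] indices [i] within [m] of [0] or [k].  So, along the orbit of
[x], the averages over cylinders and the Birkhoff averages have the same limit,
and the pointwise ergodic theorem applies to the countably many indicators of
windows.  By compactness the linear combinations of these indicators are
uniformly dense in the continuous functions, and the averages are linear
contractions for the uniform norm.  As only countably many conditions are left,
each given by functions of finitely many coordinates of [x], the set of good
points is measurable.

The ergodic theorem is obtained from [G_0 = 0], [G_(n+1) = max 0 (g + G_n \o T)].
The set where [G_n] is unbounded is invariant; if it has full measure, then
[G_(n+1) - G_n \o T = max (- G_n \o T) g] has nonnegative integral and converges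
to [g], so that [g] has nonnegative integral.  Hence the sums of [g] along
orbits are a.e. bounded above when the integral of [g] is negative; apply this
to [u - c] and [c' - u] for [c' < \int u < c] arbitrarily close. *)

(** * Birkhoff's ergodic theorem *)

Section birkhoff.
Context d (Y : measurableType d) (R : realType) (mu : probability Y R).
Variable T : Y -> Y.
Implicit Types g u : Y -> R.

(** Unfolded, this is the maximum over [0 <= j <= n] of the sums of [g] over the first [j] points of
    the orbit of [x], the empty sum included. *)
Fixpoint peak g (n : nat) (x : Y) : R :=
  if n is n'.+1 then Num.max 0 (g x + peak g n' (T x)) else 0.

Lemma peak_ge0 g n x : 0 <= peak g n x.
Proof. by case: n => //= n; rewrite le_max lexx. Qed.

Lemma peak_leS g n x : peak g n x <= peak g n.+1 x.
Proof.
elim: n x => [|n IH] x; first exact: peak_ge0.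
rewrite [leRHS]/= [leLHS]/= ge_max !le_max lexx /=; apply/orP; right.
by rewrite lerD2l; exact: IH.
Qed.

Lemma peak_homo g x : {homo peak g ^~ x : m n / (m <= n)%N >-> m <= n}.
Proof. by apply: homo_leq => //; [exact: le_trans|move=> n; exact: peak_leS]. Qed.

Lemma birkhoff_sum_le_peak g n x :
  \sum_(i < n) g (iter i T x) <= peak g n x.
Proof.
elim: n x => [|n IH] x; first by rewrite big_ord0.
rewrite big_ord_recl /= le_max; apply/orP; right; rewrite lerD2l.
by under eq_bigr do rewrite /bump add0n -iterS iterSr; exact: IH.
Qed.

Lemma peakS_sub g n x :
  peak g n.+1 x - peak g n (T x) = Num.max (- peak g n (T x)) (g x).
Proof. by rewrite /= addr_maxl sub0r addrK. Qed.

Definition unbounded_peaks g : set Y :=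
  [set x | forall m : nat, exists n, m%:R < peak g n x].

(** One step of [T] changes a positive peak by [g x] and shifts the index by one. Raising the
    threshold [m] by an integer above [|g x|] absorbs this change in either direction. *)
Lemma preimage_unbounded_peaks g :
  T @^-1` unbounded_peaks g = unbounded_peaks g.
Proof.
apply/seteqP; split => x /= Ex m.
  have [n hn] := Ex (m + Num.bound `|g x|)%N; exists n.+1.
  rewrite /= lt_max; apply/orP; right; move: hn; rewrite natrD.
  have := archi_boundP (normr_ge0 (g x)); have := ler_norm (- g x).
  by rewrite normrN; lra.
have [[|n]] := Ex (m + Num.bound `|g x|)%N; first by rewrite ltrn0.
rewrite /= lt_max ltrn0 /= natrD => hn; exists n; move: hn.
have := archi_boundP (normr_ge0 (g x)); have := ler_norm (g x); lra.
Qed.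

Hypothesis Tinv : invariant_measure mu T.

Lemma measurable_iter n : measurable_fun setT (iter n T).
Proof.
elim: n => [|n IH]; first exact: measurable_id.
exact: (measurableT_comp Tinv.1 IH).
Qed.

Lemma integral_invariant g : mu.-integrable setT (EFin \o g) ->
  mu.-integrable setT (EFin \o (g \o T)) /\
  \int[mu]_x g (T x) = \int[mu]_x g x.
Proof.
move=> ig.
have mT : measurable_fun setT T by exact: Tinv.1.
have mg : measurable_fun setT g by exact/measurable_EFinP/(measurable_int mu ig).
have E D (f : Y -> \bar R) : measurable D ->
    (\int[pushforward mu T]_(x in D) f x = \int[mu]_(x in D) f x)%E.
  move=> mD; apply: eq_measure_integral => A mA _; exact: Tinv.2.
have ig' : mu.-integrable setT (EFin \o (g \o T)).
  apply/integrableP; split; first exact/measurable_EFinP/(measurableT_comp mg mT).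
  have /integrableP[_] := ig; apply: le_lt_trans.
  rewrite -(E setT (fun x => `|(EFin \o g) x|)%E)//.
  rewrite ge0_integral_pushforward//.
  by apply: measurableT_comp => //; exact/measurable_EFinP.
split => //; congr fine.
rewrite -[RHS]E// integral_pushforward//; exact/measurable_EFinP.
Qed.

Lemma integrable_peak g n : mu.-integrable setT (EFin \o g) ->
  mu.-integrable setT (EFin \o peak g n).
Proof.
move=> ig; elim: n => [|n IH]; first exact: integrable0.
have igT : mu.-integrable setT (EFin \o (fun x => g x + peak g n (T x))).
  exact: (integrableD measurableT ig (integral_invariant IH).1).
apply: le_integrable (igT) => //.
  apply/measurable_EFinP; apply: measurable_maxr => //.
  by apply/measurable_EFinP; exact: (measurable_int mu igT).
move=> x _; rewrite /= lee_fin.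
by case: (leP 0 (g x + _)) => [//|_]; rewrite normr0.
Qed.

Lemma Rintegral_ge0_of_unbounded_peaks g : mu.-integrable setT (EFin \o g) ->
  {ae mu, forall x, unbounded_peaks g x} -> 0 <= \int[mu]_x g x.
Proof.
move=> ig Eg.
pose h n x := Num.max (- peak g n (T x)) (g x).
have ipT n := (integral_invariant (integrable_peak n ig)).1.
have ih n : mu.-integrable setT (EFin \o h n).
  rewrite (_ : h n = (fun x => peak g n.+1 x - peak g n (T x))); last first.
    by apply/funext => x; rewrite peakS_sub.
  exact: (integrableB measurableT (integrable_peak n.+1 ig) (ipT n)).
have h0 n : (0 <= \int[mu]_x (h n x)%:E)%E.
  rewrite -(fineK (integrable_fin_num measurableT (ih n))) lee_fin.
  rewrite -[X in 0 <= X]/(\int[mu]_x h n x).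
  rewrite (_ : h n = (fun x => peak g n.+1 x - peak g n (T x))); last first.
    by apply/funext => x; rewrite peakS_sub.
  rewrite (RintegralB measurableT (integrable_peak n.+1 ig) (ipT n)).
  rewrite (integral_invariant (integrable_peak n ig)).2 subr_ge0.
  apply: le_Rintegral => //; [exact: integrable_peak|exact: integrable_peak|].
  by move=> x _; exact: peak_leS.
(* The dominating function is [|g|]: where [h n] differs from [g], it equals [- peak g n (T x)],
   which lies between [g x] and [0]. *)
have [] := @dominated_convergence _ _ _ mu setT measurableT
  (fun n => EFin \o h n) (EFin \o g) (abse \o (EFin \o g)).
- by move=> n; exact: (measurable_int mu (ih n)).
- exact: (measurable_int mu ig).
- apply: filterS Eg => x; rewrite -{1}preimage_unbounded_peaks => Ex _.
  (* By invariance the peaks at [T x] are unbounded too. Once one exceeds [|g x|], monotonicity in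
     [n] keeps the maximum equal to [g x]. *)
  apply: cvg_near_cst; have [n hn] := Ex (Num.bound `|g x|).
  exists n => // k /= nk; congr EFin; apply/max_idPr.
  have := peak_homo g (T x) nk; have := archi_boundP (normr_ge0 (g x)).
  by have := ler_norm (- g x); rewrite normrN; lra.
- exact: integrable_abse.
- apply: aeW => x n _; rewrite /= lee_fin /h.
  have := peak_ge0 g n (T x); case: (leP _ (g x)) => // hg p0.
  rewrite !ler0_norm ?oppr_le0//; last by rewrite (le_trans (ltW hg))// oppr_le0.
  by rewrite lerN2 ltW.
move=> _ _ lim; apply: fine_ge0; rewrite -(cvg_lim _ lim)//.
by apply: lime_ge; [exact: cvgP lim|exact: nearW].
Qed.

Lemma measurable_unbounded_peaks g : mu.-integrable setT (EFin \o g) ->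
  measurable (unbounded_peaks g).
Proof.
move=> ig.
rewrite (_ : unbounded_peaks g =
    \bigcap_m \bigcup_n peak g n @^-1` `]m%:R, +oo[%classic).
  apply: bigcap_measurableType => m _; apply: bigcup_measurable => n _.
  rewrite -[X in measurable X]setTI.
  have /measurable_EFinP mp := measurable_int mu (integrable_peak n ig).
  by apply: mp => //; exact: measurable_itv.
apply/seteqP; split => x Ex m.
  by move=> _; have [n hn] := Ex m; exists n => //=; rewrite in_itv/= andbT.
by have [n _] := Ex m I; rewrite /= in_itv/= andbT => hn; exists n.
Qed.

End birkhoff.

(** * Almost everywhere convergence of Birkhoff averages *)

Section ergodic.
Context d (Y : measurableType d) (R : realType) (mu : probability Y R).
Variable T : Y -> Y.
Hypothesis ergT : ergodic mu T.
Implicit Types g u : Y -> R.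

(** The invariant set of unbounded peaks has measure 0 or 1, and measure 1 would make the integral
    nonnegative. Off this set, a bound on the peaks bounds the sums. *)
Lemma ae_birkhoff_sum_bounded g :
  mu.-integrable setT (EFin \o g) -> \int[mu]_x g x < 0 ->
  {ae mu, forall x, exists M : R, forall n, \sum_(i < n) g (iter i T x) <= M}.
Proof.
move=> ig g0; have mE := measurable_unbounded_peaks ergT.1 ig.
have [E0|E1] := ergT.2 _ mE (preimage_unbounded_peaks T g).
  exists (unbounded_peaks T g); split => // x /= xM.
  apply: contrapT => /existsNP[m /forallNP hm]; apply: xM.
  exists m%:R => n; apply: le_trans (birkhoff_sum_le_peak _ _ _ _) _.
  by rewrite leNgt; apply/negP/hm.
suff : 0 <= \int[mu]_x g x by rewrite leNgt g0.
apply: (Rintegral_ge0_of_unbounded_peaks ergT.1 ig).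
exists (~` unbounded_peaks T g); split => //; first exact: measurableC.
by rewrite probability_setC// E1 subee.
Qed.

Lemma ae_birkhoff_avg_le u : mu.-integrable setT (EFin \o u) ->
  {ae mu, forall x, forall m : nat, \forall n \near \oo,
     n%:R^-1 * \sum_(i < n) u (iter i T x) <= \int[mu]_x u x + m.+1%:R^-1}.
Proof.
move=> iu; apply: ae_foralln => m.
(* Half of the margin [m.+1%:R^-1] makes the integral of [u - c] negative. The other half absorbs
   [M / n], where [M] bounds the sums of [u - c]. *)
pose c := \int[mu]_x u x + m.+1%:R^-1 / 2.
have ic : mu.-integrable setT (EFin \o (fun=> c)).
  exact: finite_measure_integrable_cst.
have ig : mu.-integrable setT (EFin \o (fun x => u x - c)).
  exact: (integrableB measurableT iu ic).
have := ae_birkhoff_sum_bounded ig.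
rewrite RintegralB// Rintegral_cst//.
rewrite (_ : fine (mu setT) = 1) ?mulr1; last first.
  by rewrite -[X in fine X]/(mu setT) (probability_setT mu).
have m0 : 0 < m.+1%:R^-1 / 2 :> R by rewrite divr_gt0.
rewrite /c opprD addrA subrr sub0r oppr_lt0 => /(_ m0); apply: filterS => x [M hM].
exists (Num.bound (`|M| / (m.+1%:R^-1 / 2))).+1 => //= -[//|n] /= Nn.
rewrite mulrC ler_pdivrMr//.
have := hM n.+1; rewrite big_split/= sumr_const card_ord -[_ *+ n.+1]mulr_natr.
have Mn : M <= m.+1%:R^-1 / 2 * n.+1%:R.
  rewrite (le_trans (ler_norm M))// mulrC -ler_pdivrMr//.
  have /archi_boundP /ltW /le_trans : 0 <= `|M| / (m.+1%:R^-1 / 2).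
    by rewrite divr_ge0// ltW.
  by apply; rewrite ler_nat ltnW.
rewrite -lerBrDr => /le_trans; apply.
rewrite -opprD mulNr opprK (le_trans (lerD Mn (lexx _)))// -mulrDl.
by rewrite addrCA -splitr.
Qed.

(** The one-sided estimate for [u] gives the upper bound, and for [-1 * u] the lower bound. *)
Theorem birkhoff_ergodic u : mu.-integrable setT (EFin \o u) ->
  {ae mu, forall x,
    n%:R^-1 * \sum_(i < n) u (iter i T x) @[n --> \oo] --> \int[mu]_x u x}.
Proof.
move=> iu.
have iNu : mu.-integrable setT (EFin \o (fun x => - 1 * u x)).
  exact: (integrableZl measurableT (-1) iu).
have := ae_birkhoff_avg_le iNu; rewrite RintegralZl// => lb.
apply: filterS2 (ae_birkhoff_avg_le iu) lb => x ub lb.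
apply/cvgrPdist_le => e e0.
have [m me] : exists m : nat, m.+1%:R^-1 <= e.
  exists (Num.bound e^-1); rewrite invf_ple ?posrE//.
  have /archi_boundP /ltW /le_trans : 0 <= e^-1 by rewrite invr_ge0 ltW.
  by apply; rewrite ler_nat.
apply: filterS2 (ub m) (lb m) => n; rewrite -mulr_sumr ler_distlC.
set s := \sum_(i < n) _; set k := n%:R^-1; set I := \int[mu]_x _.
rewrite mulrCA !mulN1r [in X in _ -> X -> _]lerNl opprD opprK => ub_n lb_n.
by rewrite (le_trans _ lb_n) ?lerD2l ?lerN2// (le_trans ub_n) ?lerD2l.
Qed.

End ergodic.

(** * Windows in a subshift *)

Section full_shift_topology.
Variable D : finType.
Implicit Types x y z : full_shift D.

Definition agree (m : nat) x y := forall n : int, (`|n| <= m)%N -> y n = x n.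

Lemma agreexx m x : agree m x x. Proof. by []. Qed.

Lemma agree_sym m x y : agree m x y -> agree m y x.
Proof. by move=> xy n /xy. Qed.

Lemma agree_trans m y x z : agree m x y -> agree m y z -> agree m x z.
Proof. by move=> xy yz n nm; rewrite yz// xy. Qed.

Lemma agree_le m n x y : (m <= n)%N -> agree n x y -> agree m x y.
Proof. by move=> mn xy i im; apply: xy; exact: leq_trans im mn. Qed.

Lemma near_coord_eq x (n : int) : \forall y \near x, y n = x n.
Proof.
have := @proj_continuous int (fun=> discrete_topology D) n x.
move/(_ [set x n]); rewrite /= nbhs_simpl /=; apply.
by rewrite nbhs_principalE => A.
Qed.

Lemma near_agree m x : \forall y \near x, agree m x y.
Proof.
elim: m => [|m IH].
  apply: filterS (near_coord_eq x 0) => y y0 n.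
  by rewrite leqn0 absz_eq0 => /eqP ->.
near=> y => n; rewrite leq_eqVlt => /orP[/eqP nm|]; last first.
  by rewrite ltnS; exact: (near IH y).
have : n = m.+1%:Z \/ n = - m.+1%:Z by case: n nm => n' /=; lia.
by case=> ->; [near: y; exact: near_coord_eq|near: y; exact: near_coord_eq].
Unshelve. all: by end_near. Qed.

(** The windows around [x] generate a filter that converges to [x] in each coordinate, hence in the
    product topology. So it contains every neighbourhood of [x]. *)
Lemma nbhs_agree x (A : set (full_shift D)) :
  nbhs x A -> exists m, [set y | agree m x y] `<=` A.
Proof.
pose F := filter_from [set: nat] (fun m => [set y | agree m x y]).
have FF : Filter F.
  apply: filter_from_filter; first by exists 0%N.
  move=> m n _ _; exists (maxn m n) => // y xy.
  by split; apply: agree_le xy; rewrite ?leq_maxl ?leq_maxr.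
suff : F --> x by move=> /[apply] -[m _ mA]; exists m.
apply/(@pointwise_cvgP (discrete_topology int) (discrete_topology D) F x) => n A'.
rewrite nbhs_principalE => A'x; exists `|n|%N => // y /= xy.
by rewrite xy//; exact: A'x.
Qed.

End full_shift_topology.

Section subshift_topology.
Variables (D : finType) (X : subshift D).

Lemma near_agree_sub m (x : X) : \forall y \near x, agree m (val x) (val y).
Proof.
have : continuous (val : X -> full_shift D) by exact: initial_continuous.
by move=> /(_ x); apply; exact: near_agree.
Qed.

Lemma open_agree_closed (A : set X) m :
  (forall x y : X, agree m (val x) (val y) -> A x -> A y) -> open A.
Proof.
move=> Am; rewrite openE => x Ax.
by apply: filterS (near_agree_sub m x) => y /Am; exact.
Qed.

Lemma nbhs_agree_sub (x : X) (A : set X) :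
  nbhs x A -> exists m, [set y : X | agree m (val x) (val y)] `<=` A.
Proof.
rewrite nbhsE/= => -[B [oB Bx] BA]; have [C oC CB] := oB.
have Cx : nbhs (val x) C by apply: open_nbhs_nbhs; split => //; rewrite -CB in Bx.
have [m mC] := nbhs_agree Cx; exists m => y xy; apply: BA; rewrite -CB.
exact: mC.
Qed.

(** This is uniform continuity by compactness. The predicate [P] has a free centre [z] in the full
    shift, since compactness is that of a subset of this space; at the end the centre is [x]
    itself. *)
Lemma continuous_agree (K : numFieldType) (f : X -> K^o) : continuous f ->
  forall e : K, 0 < e -> exists m, forall x y : X,
    agree m (val x) (val y) -> `|f x - f y| < e.
Proof.
move=> cf e e0.
pose P m z := forall x y : X, agree m z (val x) -> agree m z (val y) ->
  `|f x - f y| < e.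
have /compact_near_coveringP/(_ nat \oo P _) := @subshift_compact D X.
case=> [z Xz|m _ mP].
  have e2 : 0 < e / 2 by rewrite divr_gt0.
  pose z' : X := exist _ z (mem_set Xz).
  have /cvgrPdist_lt/(_ _ e2)/nbhs_agree_sub[m mf] := cf z'.
  near=> z1 n => x y z1x z1y.
  have zz1 : agree m z z1 by near: z1; exact: near_agree.
  have mn : (m <= n)%N by near: n; exact: nbhs_infty_ge.
  have fx := mf x (agree_trans zz1 (agree_le mn z1x)).
  have fy := mf y (agree_trans zz1 (agree_le mn z1y)).
  rewrite (splitr e) (le_lt_trans (ler_distD (f z') _ _))//.
  by rewrite distrC ltrD.
by exists m => x y; apply: (mP m (leqnn m)); [exact: set_mem (valP x)|exact: agreexx].
Unshelve. all: by end_near. Qed.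

End subshift_topology.

(** * Functions of finitely many coordinates *)

Definition uniformly_local (R : realType) (D : finType) (X : subshift D)
    (u : X -> R) :=
  forall e : R, 0 < e -> exists m, forall x y : X,
    agree m (val x) (val y) -> `|u x - u y| < e.

Section words.
Context (D : finType) (X : subshift D).

(** Index [j] stands for coordinate [j - m], so the indices below [2m + 1] cover the window from
    [-m] to [m]. As a finite function, a word ranges over a finite type. *)
Definition word (m : nat) (x : X) : {ffun 'I_(m.*2.+1) -> D} :=
  [ffun j : 'I_(m.*2.+1) => val x (j%:Z - m%:Z)].

Lemma wordP m (x y : X) : word m x = word m y <-> agree m (val x) (val y).
Proof.
split => [/ffunP xy n nm|xy].
  have h : (absz (n + m%:Z)%R < m.*2.+1)%N by lia.
  have := xy (Ordinal h); rewrite !ffunE /=.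
  by rewrite (_ : (absz (n + m%:Z))%:Z - m%:Z = n)//; lia.
apply/ffunP => j; rewrite !ffunE xy//.
by have := ltn_ord j; lia.
Qed.

Definition word_ind (R : realType) (m : nat) (w : {ffun 'I_(m.*2.+1) -> D})
  (x : X) : R := (word m x == w)%:R.

Lemma uniformly_local_approx (R : realType) (u : X -> R) :
  uniformly_local u -> forall e : R, 0 < e ->
  exists m (a : {ffun 'I_(m.*2.+1) -> D} -> R),
    forall x, `|u x - \sum_w a w * word_ind R w x| < e.
Proof.
move=> uu e /uu[m um]; exists m.
(* The coefficient of [w] is the value of [u] at a chosen point with word [w], and 0 when [w] does
   not occur in [X]. At [x] only the term of its own word survives. *)
exists (fun w => if pselect (exists x, word m x = w) is left h
                 then u (projT1 (cid h)) else 0) => x.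
rewrite (bigD1 (word m x))//= big1 ?addr0; last first.
  by move=> w /negPf; rewrite /word_ind eq_sym => ->; rewrite mulr0.
rewrite /word_ind eqxx mulr1; case: pselect => [h|]; last by case; exists x.
by apply: um; apply/wordP; case: cid.
Qed.

End words.

(** * Borel measurability from dependence on coordinates *)

Section borel.
Context (R : realType) (D : finType) (X : subshift D).
Context (X0 : (X : set (full_shift D)) !=set0).
Local Notation Y := (borel_subshift X0).

Lemma open_borel_measurable (A : set X) : open A -> measurable (A : set Y).
Proof. by move=> oA; apply: sub_sigma_algebra. Qed.

Lemma agree_closed_measurable (A : set X) m :
  (forall x y : X, agree m (val x) (val y) -> A x -> A y) ->
  measurable (A : set Y).
Proof. by move/open_agree_closed; exact: open_borel_measurable. Qed.

Lemma agree_invariant_measurable (u : X -> R) m :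
  (forall x y : X, agree m (val x) (val y) -> u x = u y) ->
  measurable_fun setT (u : Y -> R).
Proof.
move=> um _ B _; rewrite setTI; apply: (@agree_closed_measurable _ m) => x y.
by rewrite /preimage /= => /um ->.
Qed.

Lemma uniformly_local_measurable (u : X -> R) : uniformly_local u ->
  measurable_fun setT (u : Y -> R).
Proof.
move=> uu; apply: (measurability _ (RGenOInfty.measurableE R)).
move=> /= _ [_ [a ->]] <-; rewrite setTI; apply: open_borel_measurable.
rewrite openE => x; rewrite /= in_itv /= andbT => ax.
have [|m um] := uu (u x - a); first by rewrite subr_gt0.
apply: filterS (near_agree_sub m x) => y /um.
rewrite /= in_itv /= andbT; have := ler_norm (u x - u y); lra.
Qed.

Lemma uniformly_local_bounded (u : X -> R) : uniformly_local u ->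
  exists M, forall x, `|u x| <= M.
Proof.
move=> /uniformly_local_approx/(_ 1 ltr01)[m [a am]].
exists (1 + \sum_w `|a w|) => x.
rewrite -(subrK (\sum_w a w * word_ind R w x) (u x)).
rewrite (le_trans (ler_normD _ _))// lerD ?(ltW (am x))//.
rewrite (le_trans (ler_norm_sum _ _ _))// ler_sum// => w _.
by rewrite normrM ler_piMr// /word_ind; case: eqP; rewrite ?normr0 ?normr1.
Qed.

End borel.

(** * Averages along orbits *)

Section mean.
Context d (Y : measurableType d) (R : realType) (mu : probability Y R).
Implicit Types (u v : Y -> R) (F : set Y).

Definition bounded_mfun u :=
  measurable_fun setT u /\ exists M, forall x, `|u x| <= M.

Lemma bounded_mfun_integrable u F : measurable F -> bounded_mfun u ->
  mu.-integrable F (EFin \o u).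
Proof.
move=> mF [mu_ [M uM]]; apply: measurable_bounded_integrable => //.
- by rewrite (le_lt_trans (probability_le1 mu mF)) ?ltry.
- exact: measurable_funTS.
- exists M; split; first exact: num_real.
  by move=> r Mr x _; rewrite /= (le_trans (uM x)) ?ltW.
Qed.

Lemma bounded_mfunD u v : bounded_mfun u -> bounded_mfun v ->
  bounded_mfun (fun x => u x + v x).
Proof.
move=> [mu_ [M uM]] [mv [N vN]]; split; first exact: measurable_funD.
by exists (M + N) => x; rewrite (le_trans (ler_normD _ _))// lerD.
Qed.

Lemma bounded_mfunZ r u : bounded_mfun u -> bounded_mfun (fun x => r * u x).
Proof.
move=> [mu_ [M uM]]; split; first exact: measurable_funM.
by exists (`|r| * M) => x; rewrite normrM ler_wpM2l.
Qed.

Lemma bounded_mfun_comp u (T : Y -> Y) : measurable_fun setT T ->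
  bounded_mfun u -> bounded_mfun (u \o T).
Proof.
move=> mT [mu_ [M uM]]; split; first exact: measurableT_comp.
by exists M => x; exact: uM.
Qed.

Lemma bounded_mfun_cst r : bounded_mfun (fun=> r).
Proof. by split; [exact: measurable_cst|exists `|r|]. Qed.

(** The real counterpart of [average], with the same value 0 on null sets. [averageE] relates the
    two. *)
Definition mean F u : R := (fine (mu F))^-1 * \int[mu]_(x in F) u x.

Lemma meanD F u v : measurable F -> bounded_mfun u -> bounded_mfun v ->
  mean F (fun x => u x + v x) = mean F u + mean F v.
Proof.
move=> mF bu bv; rewrite /mean RintegralD ?mulrDr//;
exact: bounded_mfun_integrable.
Qed.

Lemma meanZ F r u : measurable F -> bounded_mfun u ->
  mean F (fun x => r * u x) = r * mean F u.
Proof.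
move=> mF bu; rewrite /mean RintegralZl 1?mulrCA//.
exact: bounded_mfun_integrable.
Qed.

Lemma meanT u : mean setT u = \int[mu]_x u x.
Proof.
rewrite /mean (_ : fine (mu setT) = 1) ?invr1 ?mul1r//.
by rewrite -[X in fine X]/(mu setT) (probability_setT mu).
Qed.

Lemma mean_cst F r : measurable F -> (0 < mu F)%E -> mean F (fun=> r) = r.
Proof.
move=> mF F0; rewrite /mean Rintegral_cst// mulrC mulfK// gt_eqF// fine_gt0// F0.
by rewrite (le_lt_trans (probability_le1 mu mF)) ?ltry.
Qed.

Lemma le_norm_mean F u e : measurable F -> bounded_mfun u ->
  (forall x, F x -> `|u x| <= e) -> 0 <= e -> `|mean F u| <= e.
Proof.
move=> mF bu ue e0.
have iu := bounded_mfun_integrable mF bu.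
have : `|\int[mu]_(x in F) u x| <= e * fine (mu F).
  rewrite (le_trans (le_normr_Rintegral _ _))// -Rintegral_cst//.
  apply: le_Rintegral => //; first exact: integrable_norm.
  exact/bounded_mfun_integrable/bounded_mfun_cst.
have F0 : 0 <= fine (mu F) by exact: fine_ge0.
rewrite /mean normrM normfV (ger0_norm F0).
(* On a null set the mean is 0 by the convention for the inverse, so the bound needs no positivity
   of [mu F]. *)
have [F00|F1] := eqVneq (fine (mu F)) 0; first by rewrite F00 invr0 mul0r.
by rewrite ler_pdivrMl ?lt_def ?F1// mulrC.
Qed.

Variables (T : Y -> Y) (mT : measurable_fun setT T).

Let mTi i : measurable_fun setT (iter i T).
Proof.
by elim: i => [|i IH]; [exact: measurable_id|exact: (measurableT_comp mT IH)].
Qed.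

Let bTi u i : bounded_mfun u -> bounded_mfun (u \o iter i T).
Proof. exact: bounded_mfun_comp. Qed.

Definition orbit_mean (k : nat) F u : R :=
  k%:R^-1 * \sum_(i < k) mean F (u \o iter i T).

Lemma orbit_meanD k F u v : measurable F -> bounded_mfun u -> bounded_mfun v ->
  orbit_mean k F (fun x => u x + v x) = orbit_mean k F u + orbit_mean k F v.
Proof.
move=> mF bu bv; rewrite /orbit_mean -[RHS]mulrDr -big_split; congr (_ * _).
by apply: eq_bigr => i _; apply: meanD => //; exact: bTi.
Qed.

Lemma orbit_meanZ k F r u : measurable F -> bounded_mfun u ->
  orbit_mean k F (fun x => r * u x) = r * orbit_mean k F u.
Proof.
move=> mF bu; rewrite /orbit_mean [RHS]mulrCA [X in _ = _ * X]mulr_sumr; congr (_ * _).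
by apply: eq_bigr => i _; apply: meanZ => //; exact: bTi.
Qed.

Lemma le_norm_orbit_mean k F u e : measurable F -> bounded_mfun u ->
  (forall x, `|u x| <= e) -> 0 <= e -> `|orbit_mean k F u| <= e.
Proof.
move=> mF bu ue e0; rewrite /orbit_mean normrM normfV normr_nat.
case: k => [|k]; first by rewrite big_ord0 normr0 mulr0.
rewrite ler_pdivrMl// (le_trans (ler_norm_sum _ _ _))//.
rewrite -[X in X%:R * _]card_ord mulr_natl -sumr_const ler_sum// => i _.
by apply: le_norm_mean => //; [exact: bTi|move=> x _; exact: ue].
Qed.

(** * Closure of equidistribution under linear combinations and uniform limits *)

Section convergence.
Variable F : nat -> set Y.
Hypothesis mF : forall k, measurable (F k).

Definition equidistributed u := orbit_mean k (F k) u @[k --> \oo] --> \int[mu]_x u x.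

Lemma equidistributed_sum (I : finType) (a : I -> R) (u : I -> Y -> R) :
  (forall i, bounded_mfun (u i)) -> (forall i, equidistributed (u i)) ->
  bounded_mfun (fun x => \sum_i a i * u i x) /\
  equidistributed (fun x => \sum_i a i * u i x).
Proof.
move=> bu eu.
(* Boundedness goes through the induction together with convergence, because splitting off one term
   uses that the remaining sum is integrable. *)
elim: (index_enum I) => [|i s [bs es]].
  under eq_fun do rewrite big_nil; split; first exact: bounded_mfun_cst.
  rewrite /equidistributed Rintegral_cst// mul0r.
  rewrite (_ : (fun k => _) = cst 0); first exact: cvg_cst.
  apply/funext => k; rewrite /orbit_mean big1 ?mulr0// => i _.
  by rewrite /mean Rintegral_cst// mul0r mulr0.
under eq_fun do rewrite big_cons.
have bi := bounded_mfunZ (a i) (bu i).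
split; first exact: bounded_mfunD.
rewrite /equidistributed RintegralD//; try exact: bounded_mfun_integrable.
rewrite RintegralZl//; last exact: bounded_mfun_integrable.
under eq_fun do rewrite orbit_meanD// orbit_meanZ//.
by apply: cvgD => //; apply: cvgM; [exact: cvg_cst|exact: eu].
Qed.

(** Three errors of [e / 3]: orbit means and the integral are both contractions for the uniform
    norm, and [v] contributes its own convergence error. The integral is treated as the mean over
    the whole space. *)
Lemma equidistributed_uniform_limit u : bounded_mfun u ->
  (forall e, 0 < e -> exists v,
    [/\ bounded_mfun v, equidistributed v & forall x, `|u x - v x| <= e]) ->
  equidistributed u.
Proof.
move=> bu uv; apply/cvgrPdist_le => e e0.
have e3 : 0 < e / 3 by rewrite divr_gt0.
have [v [bv ev uve]] := uv _ e3.
move/cvgrPdist_le/(_ _ e3): (ev); apply: filterS => k kv.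
have bNv := bounded_mfunZ (-1) bv; have buv := bounded_mfunD bu bNv.
have uve' x : `|u x + -1 * v x| <= e / 3 by rewrite mulN1r.
have := le_norm_orbit_mean k (mF k) buv uve' (ltW e3).
rewrite orbit_meanD// orbit_meanZ// mulN1r.
have := le_norm_mean measurableT buv (fun x _ => uve' x) (ltW e3).
rewrite meanD// meanZ// !meanT mulN1r.
set U := \int[mu]_x u x; set V := \int[mu]_x v x in kv *.
move: kv; rewrite !ler_norml => /andP[? ?] /andP[? ?] /andP[? ?].
by apply/andP; split; lra.
Qed.

End convergence.
End mean.

(** * Complex-valued averages *)

Section complex.
Variable R : realType.

Lemma norm_complex_le (z : R[i]) (e : R) :
  `|complex.Re z| <= e -> `|complex.Im z| <= e -> `|z| <= (e + e)%:C%C.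
Proof.
move=> Re Ie; rewrite normc_def lecR.
have e0 : 0 <= e by rewrite (le_trans _ Re).
rewrite -(ler_pXn2r (ltn0Sn 1)) ?nnegrE ?sqrtr_ge0 ?addr_ge0//.
rewrite sqr_sqrtr ?addr_ge0 ?sqr_ge0//.
rewrite -(real_normK (num_real (complex.Re z))) -(real_normK (num_real (complex.Im z))).
have := @ler_pM R `|complex.Re z| e `|complex.Re z| e.
have := @ler_pM R `|complex.Im z| e `|complex.Im z| e.
rewrite !normr_ge0 Re Ie => /(_ isT isT isT isT) h1 /(_ isT isT isT isT) h2.
by rewrite !expr2 mulrDl !mulrDr; nra.
Qed.

Lemma norm_Im_le (z : R[i]) : `|complex.Im z|%:C%C <= `|z|.
Proof.
rewrite normc_def lecR -sqrtr_sqr ler_wsqrtr// lerDr sqr_ge0//.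
Qed.

Lemma cvg_complexP (f : nat -> R[i]) (l : R[i]) :
  ((f : nat -> R[i]^o) @ \oo --> (l : R[i]^o)) <->
  ((fun x => complex.Re (f x)) @ \oo --> complex.Re l /\
   (fun x => complex.Im (f x)) @ \oo --> complex.Im l).
Proof.
split => [/cvgrPdist_lt fl|[/cvgrPdist_lt fR /cvgrPdist_lt fI]].
  split; apply/cvgrPdist_lt => e e0.
    have /fl : 0 < e%:C%C :> R[i] by rewrite ltcR.
    apply: filterS => k; rewrite -ltcR; apply: le_lt_trans.
    rewrite /= -raddfB; exact: normc_ge_Re.
  have /fl : 0 < e%:C%C :> R[i] by rewrite ltcR.
  apply: filterS => k; rewrite -ltcR; apply: le_lt_trans.
  rewrite /= -raddfB; exact: norm_Im_le.
(* In the partial order of [R[i]], a positive element has zero imaginary part, so the tolerance is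
   real. *)
apply/cvgrPdist_le => -[e e'] ; rewrite ltcE /= => /andP[/eqP -> e0].
have e2 : 0 < e / 2 by rewrite divr_gt0.
apply: filterS2 (fR _ e2) (fI _ e2) => k kR kI.
rewrite -[X in (X +i* _)%C]/e [e in (e +i* _)%C]splitr.
by apply: norm_complex_le; rewrite raddfB; exact: ltW.
Qed.

Lemma real_complex_mul (r : R) (z : R[i]) :
  (r%:C%C) * z = ((r * complex.Re z) +i* (r * complex.Im z))%C.
Proof. by case: z => a b; rewrite /= ; simpc. Qed.

Lemma sum_complex (I : Type) (s : seq I) (f : I -> R[i]) :
  \sum_(i <- s) f i = ((\sum_(i <- s) complex.Re (f i)) +i*
                       (\sum_(i <- s) complex.Im (f i)))%C.
Proof.
elim: s => [|i s IH]; first by rewrite !big_nil.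
by rewrite !big_cons IH; case: (f i) => a b; simpc.
Qed.

Lemma averageE d (Y : measurableType d) (mu : probability Y R) (F : set Y)
    (f : Y -> R[i]) : average mu F f =
  (mean mu F ((fun x => complex.Re (f x))) +i* mean mu F ((fun x => complex.Im (f x))))%C.
Proof. by rewrite /average -fmorphV real_complex_mul. Qed.

Lemma orbit_averageE d (Y : measurableType d) (mu : probability Y R)
    (T : Y -> Y) (F : set Y) (f : Y -> R[i]) k :
  k%:R^-1 * \sum_(i < k) average mu F (f \o iter i T) =
  (orbit_mean mu T k F ((fun x => complex.Re (f x))) +i*
   orbit_mean mu T k F ((fun x => complex.Im (f x))))%C.
Proof.
under eq_bigr do rewrite averageE.
by rewrite sum_complex -(rmorph_nat (real_complex R)) -fmorphV real_complex_mul.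
Qed.

End complex.

(** * Cylinders *)

Lemma sum_near_endpoints (m k : nat) :
  (\sum_(i < k) ((i < m) || (k <= i + m)) <= m.*2)%N.
Proof.
have le_m n : (\sum_(i < n) (i < m) <= m)%N.
  suff -> : (\sum_(i < n) (i < m) = minn m n)%N by exact: geq_minl.
  elim: n => [|n IH]; first by rewrite big_ord0 minn0.
  by rewrite big_ord_recr /= IH; case: ltnP => /=; lia.
rewrite -addnn; apply: leq_trans (leq_add (le_m k) (le_m k)).
(* Reversing the order of the indices turns the count near [k] into the count near [0]. *)
rewrite [X in (_ <= _ + X)%N](reindex_inj rev_ord_inj) -big_split leq_sum//= => i _.
have ik := ltn_ord i; rewrite (_ : (k - i.+1 < m) = (k <= i + m))%N; last by lia.
by case: (i < m)%N.
Qed.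

Lemma measurable_cvg_set d (Y : measurableType d) (R : realType)
    (h : nat -> Y -> R) (l : R) :
  (forall n, measurable_fun setT (h n)) ->
  measurable [set x | h n x @[n --> \oo] --> l].
Proof.
move=> mh.
rewrite (_ : [set x | _] = \bigcap_j \bigcup_N \bigcap_(n in [set n | (N <= n)%N])
    (fun x => `|l - h n x|) @^-1` `]-oo, j.+1%:R^-1[%classic).
  apply: bigcap_measurableType => j _; apply: bigcup_measurable => N _.
  apply: bigcap_measurableType => n _; rewrite -[X in measurable X]setTI.
  have : measurable_fun setT (fun x => `|l - h n x|).
    by apply: measurableT_comp => //; exact: measurable_funB.
  by apply => //; exact: measurable_itv.
apply/seteqP; split => [x /cvgrPdist_lt hl j _|x hl].
  have [N _ hN] := hl j.+1%:R^-1 ltac:(by rewrite invr_gt0).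
  by exists N => // n /= /hN; rewrite in_itv.
apply/cvgrPdist_lt => e e0.
have [j je] : exists j : nat, j.+1%:R^-1 <= e.
  exists (Num.bound e^-1); rewrite invf_ple ?posrE//.
  have /archi_boundP /ltW /le_trans : 0 <= e^-1 by rewrite invr_ge0 ltW.
  by apply; rewrite ler_nat.
have [N _ hN] := hl j I; exists N => // n /hN /=.
by rewrite in_itv /= => /lt_le_trans; exact.
Qed.

Section cylinders.
Context (R : realType) (D : finType) (X : subshift D).
Context (X0 : (X : set (full_shift D)) !=set0).
Local Notation Y := (borel_subshift X0).
Local Notation T := (@subshift_map D X).

Lemma val_iter_shift i (x : X) n : val (iter i T x) n = val x (n + i%:Z).
Proof.
elim: i n => [|i IH] n; first by rewrite addr0.
by apply: (etrans (IH (n + 1))); congr (val x _); lia.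
Qed.

(** The window of radius [m] around coordinate [i] lies within the coordinates [0] to [k - 1] that
    the cylinder fixes. *)
Lemma agree_iter_shift m i k (x y : X) : (m <= i)%N -> (i + m < k)%N ->
  cylinder k x y -> agree m (val (iter i T x)) (val (iter i T y)).
Proof.
move=> mi ik xy n nm; rewrite !val_iter_shift.
have -> : n + i%:Z = (absz (n + i%:Z))%:Z by lia.
by apply: xy; lia.
Qed.

(** This makes every quantity that depends on [x] only through [cylinder k x] locally constant in
    [x], hence measurable. *)
Lemma agree_cylinder k (x y : X) : agree k (val x) (val y) ->
  cylinder k x = cylinder k y.
Proof.
move=> xy; have E j : (j < k)%N -> val y j%:Z = val x j%:Z.
  by move=> jk; apply: xy => /=; exact: ltnW.
by apply/seteqP; split => z /= h j jk; rewrite h// E.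
Qed.

Lemma measurable_cylinder k (x : X) : measurable (cylinder k x : set Y).
Proof.
apply: (agree_closed_measurable (m := k)) => y z yz xy j jk.
by rewrite yz ?xy//=; exact: ltnW.
Qed.

Variable mu : probability Y R.

(** For each [k] there are finitely many words. The points with a given word share one cylinder, so
    those among them whose cylinder is null lie in a single null set. *)
Lemma ae_cylinder_gt0 : {ae mu, forall x, forall k, (0 < mu (cylinder k x))%E}.
Proof.
apply: ae_foralln => k.
have : {ae mu, forall x, forall w : {ffun 'I_(k.*2.+1) -> D},
    word k x = w -> (0 < mu (cylinder k x))%E}.
  apply: filter_forall => w.
  pose N := [set x : Y | word k x = w /\ mu (cylinder k x) = 0%E].
  apply: (@negligibleS _ _ _ _ N).
    move=> x /= /not_implyP[xw /negP]; rewrite -leNgt => h; split => //.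
    by apply/eqP; rewrite eq_le h measure_ge0.
  have [[x [xw x0]]|N0] := pselect (N !=set0).
    exists (cylinder k x); split => //; first exact: measurable_cylinder.
    move=> y [yw _]; have : agree k (val x) (val y) by apply/wordP; rewrite xw yw.
    by move/agree_cylinder ->.
  suff -> : N = set0 by exact: negligible_set0.
  by apply/seteqP; split => // x Nx; apply: N0; exists x.
by apply: (@filterS _ _ (ae_filter_ringOfSetsType mu)) => x /(_ (word k x) erefl).
Qed.

End cylinders.

(** * Equidistribution along cylinders *)

Section equidistribution.
Context (R : realType) (D : finType) (X : subshift D).
Context (X0 : (X : set (full_shift D)) !=set0).
Local Notation Y := (borel_subshift X0).
Variable mu : probability Y R.
Let T : Y -> Y := @subshift_map D X.
Hypothesis Tinv : invariant_measure mu T.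

Lemma orbit_mean_cylinder_sub (u : Y -> R) m k (x : X) :
  (forall y z : X, agree m (val y) (val z) -> u y = u z) ->
  (forall y, 0 <= u y <= 1) -> (0 < mu (cylinder k x))%E ->
  `|orbit_mean mu T k (cylinder k x) u - k%:R^-1 * \sum_(i < k) u (iter i T x)|
    <= k%:R^-1 * m.*2%:R.
Proof.
move=> um u01 C0; have mC := @measurable_cylinder D X X0 k x.
have u_le y z : `|u y - u z| <= 1.
  by have /andP[? ?] := u01 y; have /andP[? ?] := u01 z; rewrite ler_norml; lra.
have bu : bounded_mfun u.
  split; first exact: agree_invariant_measurable um.
  by exists 1 => y; have /andP[? ?] := u01 y; rewrite ler_norml; lra.
rewrite /orbit_mean -mulrBr -sumrB normrM normfV normr_nat ler_wpM2l//.
rewrite (le_trans (ler_norm_sum _ _ _))//.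
(* Each term is at most 1 if [i] is within [m] of an end of the range, and 0 otherwise. *)
apply: (@le_trans _ _ (\sum_(i < k) ((i < m)%N || (k <= i + m)%N)%:R)); last first.
  by rewrite -natr_sum ler_nat sum_near_endpoints.
apply: ler_sum => i _; set c := u (iter i T x).
have bui : bounded_mfun (u \o iter i T).
  exact: bounded_mfun_comp (measurable_iter Tinv i) bu.
have bc := @bounded_mfun_cst _ Y R (- c).
(* Positivity of the measure of the cylinder lets the constant [c] be moved inside the mean; it then
   remains to bound [u (T^i y) - c] for [y] in the cylinder. *)
rewrite -(mean_cst (- c) mC C0) -meanD//.
apply: le_norm_mean => //; first exact: bounded_mfunD.
move=> y xy; have [_|mi] := ltnP i m; first exact: u_le.
have [_|ik] := leqP k (i + m)%N; first exact: u_le.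
rewrite /= /c (um (iter i T y) (iter i T x)) ?subrr ?normr0//.
exact/agree_sym/(agree_iter_shift mi ik).
Qed.

Lemma equidistributed_of_birkhoff (u : Y -> R) m (x : X) :
  (forall y z : X, agree m (val y) (val z) -> u y = u z) ->
  (forall y, 0 <= u y <= 1) -> (forall k, (0 < mu (cylinder k x))%E) ->
  n%:R^-1 * \sum_(i < n) u (iter i T x) @[n --> \oo] --> \int[mu]_y u y ->
  equidistributed mu T (fun k => cylinder k x) u.
Proof.
move=> um u01 C0 birk; rewrite /equidistributed.
have h0 : k%:R^-1 * m.*2%:R @[k --> \oo] --> (0 : R).
  rewrite -(mul0r m.*2%:R); apply: cvgM; last exact: cvg_cst.
  by apply/gtr0_cvgV0; [near=> k; rewrite ltr0n; near: k; exact: nbhs_infty_gt|exact: cvgr_idn].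
have d0 : orbit_mean mu T k (cylinder k x) u - k%:R^-1 * \sum_(i < k) u (iter i T x)
    @[k --> \oo] --> (0 : R).
  apply: norm_cvg0; apply: (squeeze_cvgr _ (cvg_cst 0) h0).
  by near=> k; rewrite normr_ge0 orbit_mean_cylinder_sub.
rewrite -[X in _ --> X]add0r.
rewrite (_ : (fun k => orbit_mean _ _ _ _ _) = (fun k =>
   (orbit_mean mu T k (cylinder k x) u - k%:R^-1 * \sum_(i < k) u (iter i T x))
   + k%:R^-1 * \sum_(i < k) u (iter i T x))); first exact: cvgD.
by apply/funext => k; rewrite subrK.
Unshelve. all: by end_near. Qed.

Lemma word_ind_agree m w (x y : X) : agree m (val x) (val y) ->
  @word_ind D X R m w x = word_ind R w y.
Proof. by move=> /wordP xy; rewrite /word_ind xy. Qed.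

Lemma word_ind_ge0_le1 m w (x : X) : 0 <= @word_ind D X R m w x <= 1.
Proof. by rewrite /word_ind ler0n lern1 leq_b1. Qed.

Lemma bounded_word_ind m w : bounded_mfun (@word_ind D X R m w : Y -> R).
Proof.
split; first exact: agree_invariant_measurable (@word_ind_agree m w).
by exists 1 => y; have /andP[w0 w1] := word_ind_ge0_le1 w y; rewrite ger0_norm.
Qed.

Lemma equidistributed_uniformly_local (x : X) (u : X -> R) :
  (forall m w, equidistributed mu T (fun k => cylinder k x) (@word_ind D X R m w)) ->
  uniformly_local u -> equidistributed mu T (fun k => cylinder k x) u.
Proof.
move=> ew uu; apply: (equidistributed_uniform_limit Tinv.1).
- by move=> k; exact: measurable_cylinder.
- split; first exact: uniformly_local_measurable.
  exact: uniformly_local_bounded.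
move=> e e0; have [m [a am]] := uniformly_local_approx uu e0.
have [bs es] := equidistributed_sum Tinv.1 (fun k => @measurable_cylinder D X X0 k x)
  a (bounded_word_ind (m := m)) (ew m).
by exists (fun y => \sum_w a w * word_ind R w y); split => // y; rewrite ltW.
Qed.

End equidistribution.

(** * The set of good points *)

Section equidistributed_points.
Context (R : realType) (D : finType) (X : subshift D).
Context (X0 : (X : set (full_shift D)) !=set0).
Local Notation Y := (borel_subshift X0).
Variable mu : probability Y R.
Let T : Y -> Y := @subshift_map D X.

(** This replaces the condition on all continuous functions by countably many conditions, one for
    each word, so that measurability can be proved. *)
Definition equidistributed_points : set Y :=
  [set x | forall k, (0 < mu (cylinder k x))%E] `&`
  \bigcap_m \bigcap_(w in [set: {ffun 'I_(m.*2.+1) -> D}])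
    [set x | equidistributed mu T (fun k => cylinder k x)
               (@word_ind D X R m w)].

Lemma measurable_equidistributed_points : measurable equidistributed_points.
Proof.
apply: measurableI.
  rewrite (_ : [set x | _] = \bigcap_k [set x : Y | (0 < mu (cylinder k x))%E]).
    apply: bigcap_measurableType => k _.
    by apply: (agree_closed_measurable (m := k)) => x y /agree_cylinder /= ->.
  by apply/seteqP; split => [x x0 k _|x x0 k]; exact: x0.
apply: bigcap_measurableType => m _; apply: fin_bigcap_measurable => // w _.
apply: measurable_cvg_set => n.
(* The [n]-th orbit mean sees [x] only through [cylinder n x], so it depends on finitely many
   coordinates. *)
by apply: (agree_invariant_measurable (m := n)) => x y /agree_cylinder ->.
Qed.

Hypothesis ergT : ergodic mu T.

Lemma ae_equidistributed_points : {ae mu, forall x, equidistributed_points x}.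
Proof.
have Fmu := ae_filter_ringOfSetsType mu.
have birk : {ae mu, forall x, forall m (w : {ffun 'I_(m.*2.+1) -> D}),
    n%:R^-1 * \sum_(i < n) @word_ind D X R m w (iter i T x) @[n --> \oo]
      --> \int[mu]_y word_ind R w y}.
  apply: ae_foralln => m; apply: filter_forall => w.
  apply: birkhoff_ergodic => //.
  apply: bounded_mfun_integrable => //; exact: bounded_word_ind.
apply: (@filterS2 _ _ Fmu _ _ _ _ (ae_cylinder_gt0 mu) birk) => x x0 xb.
split => // m _ w _; apply: (equidistributed_of_birkhoff ergT.1) => //.
- exact: word_ind_agree.
- exact: word_ind_ge0_le1.
Qed.

(** In one direction, the real and imaginary parts of a continuous function are uniform limits of
    combinations of word indicators. In the other, the indicators are themselves continuous, being
    locally constant. *)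
Lemma equidistributed_pointsE : equidistributed_points =
  [set x : X | (forall k : nat, (0 < mu (cylinder k x))%E) /\
    forall f : X -> R[i]^o, continuous f ->
      (fun k : nat => k%:R^-1 *
         \sum_(i < k) average mu (cylinder k x) (f \o iter i (@subshift_map D X))
         : R[i]^o) @ \oo --> (Cintegral mu setT f : R[i]^o)].
Proof.
apply/seteqP; split => x [x0 xe]; split => //.
  move=> f cf; apply/cvg_complexP.
  (* Taking real or imaginary parts is 1-Lipschitz, so the uniform continuity of [f] passes to
     both. *)
  have ul (p : R[i] -> R) : (forall z z', `|p z - p z'|%:C%C <= `|z - z'|) ->
      uniformly_local (p \o f).
    move=> lip e e0; have [|m fm] := continuous_agree cf (e := e%:C%C).
      by rewrite ltcR.
    by exists m => y z /fm; rewrite -ltcR; apply: le_lt_trans; exact: lip.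
  have ew m w : equidistributed mu T (fun k => cylinder k x) (@word_ind D X R m w).
    exact: xe.
  split; under eq_fun do rewrite (orbit_averageE mu T).
    apply: (equidistributed_uniformly_local ergT.1 ew (u := @complex.Re R \o f)).
    by apply: ul => z z'; rewrite -raddfB; exact: normc_ge_Re.
  apply: (equidistributed_uniformly_local ergT.1 ew (u := @complex.Im R \o f)).
  by apply: ul => z z'; rewrite -raddfB; exact: norm_Im_le.
move=> m _ w _.
pose f (y : X) : R[i]^o := (word_ind R w y)%:C%C.
have cf : continuous f.
  move=> y A fA; apply: filterS (near_agree_sub m y) => z /(word_ind_agree R w) yz.
  by rewrite /= /f -yz; exact: nbhs_singleton fA.
have /cvg_complexP[+ _] := xe f cf.
by under eq_fun do rewrite (orbit_averageE mu T).
Qed.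

End equidistributed_points.

Theorem theorem3p5 (R : realType) (D : finType) (X : subshift D)
    (X0 : (X : set (full_shift D)) !=set0)
    (mu : probability (borel_subshift X0) R)
    (muT : ergodic mu (@subshift_map D X)) :
  let good : set (borel_subshift X0) :=
    [set x : X | (forall k : nat, (0 < mu (cylinder k x))%E) /\
      forall f : X -> R[i]^o, continuous f ->
        (fun k : nat => k%:R^-1 *
           \sum_(i < k) average mu (cylinder k x) (f \o iter i (@subshift_map D X))
           : R[i]^o) @ \oo --> (Cintegral mu setT f : R[i]^o)] in
  measurable good /\ mu good = 1%E.
Proof.
move=> good; rewrite /good -(equidistributed_pointsE muT).
have mE := measurable_equidistributed_points mu; split=> //.
(* The complement of the good set is negligible and measurable, so its measure is 0; as it is also 1
   minus the measure of the good set, the latter is 1. *)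
have E0 := measure_negligible (measurableC mE) (ae_equidistributed_points muT).
have /esym/eqP := etrans (esym E0) (probability_setC mu mE).
by rewrite sube_eq ?add0e ?fin_num_measure// => /eqP/esym.
Qed.
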